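(* Let $r\ge 2$ and let $Q\subseteq P(r)$ be a set of partitions of $r$ such that $M=(r)\in Q$ or $R=(1,1,\ldots,1)\in Q$, and such that $Q$ is not robust. Then there exist positive integers $n,q$ and a set $\Sigma\subseteq P(r)$ such that the $\Sigma$-hypergraph $H(n,r,q\mid\Sigma)$ has a gap in its $Q$-spectrum.
   Context: $P(r)$ denotes the set of all partitions of $r$ (multisets of positive integers summing to $r$). For $\Sigma\subseteq P(r)$ and positive integers $n,q$, the $\Sigma$-hypergraph $H(n,r,q\mid\Sigma)$ is the $r$-uniform hypergraph whose vertex set is partitioned into $n$ classes $V_1,\ldots,V_n$ of $q$ vertices each, in which an $r$-subset $K$ of vertices is an edge iff the partition of $r$ formed by the nonzero numbers $|K\cap V_i|$ belongs to $\Sigma$. Given a vertex colouring, the pattern $pat(E)$ of an edge $E$ is the partition of $r$ formed by the numbers of vertices of $E$ of each colour present in $E$. A $Q$-colouring is a vertex colouring with $pat(E)\in Q$ for all edges $E$; a $k$-$Q$-colouring is a $Q$-colouring using exactly $k$ colours. The $Q$-spectrum of $H$ is the set of all $k$ such that $H$ has a $k$-$Q$-colouring; it has a gap if there are integers $k_1<k_2<k_3$ with $k_1,k_3$ in the spectrum and $k_2$ not. A partition $\pi$ is obtained from $\sigma$ by reduction if $\pi$ arises by replacing two parts $a_i,a_j$ of $\sigma$ (at distinct positions) by the single part $a_i+a_j$; by expansion if $\pi$ arises by replacing a part $a_j\ge 2$ of $\sigma$ by the two parts $a_j-1$ and $1$. $Q$ is reduction-closed if every partition obtained by a reduction from a member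 of $Q$ lies in $Q$, and expansion-closed if every partition obtained by an expansion from a member of $Q$ lies in $Q$. $Q$ is simply-closed if $Q$ contains all partitions $(r-j,1,\ldots,1)$ (with $j$ parts equal to $1$ after the first) for $0\le j\le r-1$, i.e. $(r),(r-1,1),(r-2,1,1),\ldots,(1,\ldots,1)$. $Q$ is robust if it is reduction-closed, expansion-closed, or simply-closed. *)

(* Defs.v *)
From mathcomp Require Import all_boot.
Set Implicit Arguments.
Unset Strict Implicit.
Unset Printing Implicit Defensive.

(* The multiset of parts is represented by its unique weakly decreasing
   enumeration, so that Leibniz equality is equality of partitions. *)
Definition is_intpart (r : nat) : pred (seq nat) :=
  fun s => [&& sorted geq s, all (leq 1) s & sumn s == r].

Definition reduction (s t : seq nat) : Prop :=
  exists a b u, perm_eq s [:: a, b & u] /\ perm_eq t (a + b :: u).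

Definition expansion (s t : seq nat) : Prop :=
  exists a u, [/\ 2 <= a, perm_eq s (a :: u) & perm_eq t [:: a.-1, 1 & u]].

(* In the two closure properties, [is_intpart r t] selects, among the
   orderings of the multiset obtained, the decreasing one. *)
Definition reduction_closed (r : nat) (Q : pred (seq nat)) : Prop :=
  forall s t, s \in Q -> is_intpart r t -> reduction s t -> t \in Q.

Definition expansion_closed (r : nat) (Q : pred (seq nat)) : Prop :=
  forall s t, s \in Q -> is_intpart r t -> expansion s t -> t \in Q.

Definition simply_closed (r : nat) (Q : pred (seq nat)) : Prop :=
  forall j, j < r -> (r - j) :: nseq j 1 \in Q.

Definition robust (r : nat) (Q : pred (seq nat)) : Prop :=
  [\/ reduction_closed r Q, expansion_closed r Q | simply_closed r Q].

(* The partition of #|K| formed by the sizes of the nonempty fibres of f in K.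
   It gives both the pattern of an edge (f a colouring) and the partition
   induced by the classes (f mapping a vertex to its class). *)
Definition pat (V : finType) (C : eqType) (f : V -> C) (K : {set V}) : seq nat :=
  sort geq [seq #|[set x in K | f x == c]| | c <- undup [seq f x | x in K]].

(* Vertices are pairs (i, j), and V_i is the set of pairs with first
   component i. *)
Definition sigma_hypergraph (n r q : nat) (Sigma : pred (seq nat)) :
    {set {set 'I_n * 'I_q}} :=
  [set K : {set 'I_n * 'I_q} | (#|K| == r) && (pat fst K \in Sigma)].

Definition Q_colouring (V : finType) (H : {set {set V}}) (Q : pred (seq nat))
    (f : V -> nat) : Prop :=
  forall E, E \in H -> pat f E \in Q.

Definition num_colours (V : finType) (f : V -> nat) : nat :=
  size (undup (codom f)).

Definition in_Q_spectrum (V : finType) (H : {set {set V}}) (Q : pred (seq nat))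
    (k : nat) : Prop :=
  exists f : V -> nat, Q_colouring H Q f /\ num_colours f = k.

Definition Q_spectrum_has_gap (V : finType) (H : {set {set V}})
    (Q : pred (seq nat)) : Prop :=
  exists k1 k2 k3, [/\ k1 < k2 < k3, in_Q_spectrum H Q k1,
                       in_Q_spectrum H Q k3 & ~ in_Q_spectrum H Q k2].

(* Main.v *)
(* In every case [Sigma := Q] works, with [q] and then [n] large.  Write
   hook m = (m, 1, ..., 1).
   If (r) and (1,...,1) are in Q but hook m is not, take a single vertex per
   class, so that every r-subset is an edge: a colouring with r - m + 1 colours
   has a frequent colour, hence an edge of pattern hook m.
   If (r) is in Q, (1,...,1) is not, and s in Q reduces to t not in Q: the
   spectrum contains 1 and n, but not n - 1.  Pick m with hook (m + 1) in Q and
   hook m not in Q.  A class with two colours contains m + 1 vertices of pattern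
   (m, 1) or (1,...,1); as there are many colours and at most q per class, these
   extend to an edge of pattern hook m or (1,...,1).  So all classes are
   monochromatic, exactly two of them share a colour, and some edge whose class
   partition is s has pattern t.
   If (1,...,1) is in Q, (r) is not, and s in Q expands to t not in Q: the
   spectrum contains n and n q, but not n + 1.  Pick m with hook m in Q and
   hook (m + 1) not in Q.  Extending suitable vertices to an edge of pattern
   hook (m + 1) shows that a colour occurring m times in a class occurs in no
   other class, and that each colour meets at most m classes.  Double counting
   then gives each class its own frequent colour, which leaves exactly one more
   colour; a class containing it yields an edge of pattern t. *)

Require Import Defs.
From mathcomp Require Import all_boot.
From mathcomp Require Import zify.
From Stdlib Require Import Classical_Prop.
Set Implicit Arguments.
Unset Strict Implicit.
Unset Printing Implicit Defensive.

(** * Hooks, and partitions as decreasing lists *)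

Definition hook (r m : nat) : seq nat := m :: nseq (r - m) 1.

Lemma hook_intpart r m : 0 < m <= r -> is_intpart r (hook r m).
Proof.
case/andP=> m0 mr; rewrite /is_intpart /hook /= m0 sumn_nseq mul1n subnKC // eqxx.
rewrite andbT; apply/andP; split; last by apply/allP=> x /nseqP[->].
case: (r - m) => //= k; rewrite m0 /=.
by elim: k => //= k ->; rewrite leqnn.
Qed.

Lemma hook1 r : 0 < r -> hook r 1 = nseq r 1.
Proof. by case: r => // r _; rewrite /hook subn1. Qed.

Lemma hookr r : hook r r = [:: r].
Proof. by rewrite /hook subnn. Qed.

(** Lets patterns be computed up to permutation: a multiset has only one decreasing enumeration. *)
Lemma intpart_perm r s t : is_intpart r s -> is_intpart r t -> perm_eq s t -> s = t.
Proof.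
move=> /andP[ss _] /andP[st _]; apply: (sorted_eq _ _ ss st).
- by move=> y x z /= xy yz; apply: leq_trans yz xy.
- by move=> x y /anti_leq ->.
Qed.

(** A discrete intermediate value argument; it supplies consecutive hooks of which exactly one lies
    in [Q]. *)
Lemma exists_switch (P : pred nat) a b :
  a < b -> P a -> ~~ P b -> exists m, [/\ a <= m, m < b, P m & ~~ P m.+1].
Proof.
move=> ab Pa; elim: b ab => // b IH ab nPb.
have [Pb|nPb'] := boolP (P b); first by exists b; split.
have neq : a != b by apply: contraNneq nPb' => <-.
have [|m [? ? ? ?]] := IH _ nPb'; first by lia.
by exists m; split=> //; lia.
Qed.

(** * Patterns of vertex sets *)

Section Pattern.
Variables (V : finType) (C : finType).
Implicit Types (f : V -> C) (K A B : {set V}).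

Lemma pat_perm f K :
  perm_eq (pat f K) [seq #|[set x in K | f x == c]| | c <- enum (f @: K)].
Proof.
rewrite perm_sort; apply: perm_map; apply: uniq_perm; rewrite ?undup_uniq ?enum_uniq //.
move=> c; rewrite mem_undup mem_enum; apply/imageP/imsetP.
  by case=> x xK ->; exists x.
by case=> x xK ->; exists x.
Qed.

Lemma pat_intpart f K : is_intpart #|K| (pat f K).
Proof.
rewrite /is_intpart; apply/and3P; split.
- by apply: sort_sorted => x y /=; rewrite /geq /= leq_total.
- rewrite (perm_all _ (pat_perm f K)); apply/allP => _ /mapP[c + ->].
  rewrite mem_enum => /imsetP[x xK ->]; rewrite card_gt0; apply/set0Pn; exists x.
  by rewrite inE xK eqxx.
- rewrite (perm_sumn (pat_perm f K)) sumnE big_map big_enum /=.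
  rewrite -sum1_card (partition_big_imset f) /=; apply/eqP; apply: eq_bigr => c _.
  by rewrite sum1_card -[in RHS]sum1_card; rewrite -sum1_card; apply: eq_bigl => x; rewrite inE.
Qed.

(** No colour occurs in both sets, so each fibre in the union is a whole fibre in [A] or in [B]. *)
Lemma patU f A B : (forall a b, a \in A -> b \in B -> f a != f b) ->
  perm_eq (pat f (A :|: B)) (pat f A ++ pat f B).
Proof.
move=> dis.
rewrite (perm_trans (pat_perm _ _)) // perm_sym.
rewrite (perm_trans (perm_cat (pat_perm _ _) (pat_perm _ _))) //.
have -> : [seq #|[set x in A | f x == c]| | c <- enum (f @: A)] =
   [seq #|[set x in A :|: B | f x == c]| | c <- enum (f @: A)].
  apply/eq_in_map => c; rewrite mem_enum => /imsetP[a aA ->].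
  apply: eq_card => x; rewrite !inE; have [xB|] := boolP (x \in B); last by rewrite orbF.
  by rewrite eq_sym (negbTE (dis _ _ aA xB)) !andbF.
have -> : [seq #|[set x in B | f x == c]| | c <- enum (f @: B)] =
   [seq #|[set x in A :|: B | f x == c]| | c <- enum (f @: B)].
  apply/eq_in_map => c; rewrite mem_enum => /imsetP[b bB ->].
  apply: eq_card => x; rewrite !inE; have [xA|//] := boolP (x \in A).
  by rewrite (negbTE (dis _ _ xA bB)) !andbF.
rewrite -map_cat; apply: perm_map; apply: uniq_perm; rewrite ?enum_uniq //.
  rewrite cat_uniq !enum_uniq andbT /=; apply/hasPn=> c; rewrite !mem_enum.
  move=> /imsetP[b bB ->]; apply/imsetP=> -[a aA] /eqP.
  by rewrite eq_sym (negbTE (dis _ _ aA bB)).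
by move=> c; rewrite mem_cat !mem_enum imsetU inE.
Qed.

Lemma pat_const f A c : 0 < #|A| -> (forall a, a \in A -> f a = c) ->
  pat f A = [:: #|A|].
Proof.
move=> A0 fc; apply: (intpart_perm (pat_intpart f A)).
  by rewrite /is_intpart /= A0 addn0 eqxx.
rewrite (perm_trans (pat_perm _ _)) //.
have -> : f @: A = [set c].
  apply/setP=> d; rewrite inE; apply/imsetP/eqP => [[a aA ->]|->]; first exact: fc.
  by case/card_gt0P: A0 => a aA; exists a; rewrite ?fc.
rewrite enum_set1 /=.
suff -> : [set x in A | f x == c] = A by [].
by apply/setP=> x; rewrite inE; have [/fc->|//] := boolP (x \in A); rewrite eqxx.
Qed.

Lemma pat_const2 f A B c d : 0 < #|A| -> 0 < #|B| -> c != d ->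
  (forall a, a \in A -> f a = c) -> (forall b, b \in B -> f b = d) ->
  perm_eq (pat f (A :|: B)) [:: #|A|; #|B|].
Proof.
move=> A0 B0 cd Ac Bd; rewrite -cat1s -(pat_const A0 Ac) -(pat_const B0 Bd).
by apply: patU => a b /Ac-> /Bd->.
Qed.

Lemma pat_inj f A : {in A &, injective f} -> pat f A = nseq #|A| 1.
Proof.
move=> fI; have /all_pred1P: all (pred1 1) (pat f A).
  rewrite (perm_all _ (pat_perm f A)); apply/allP=> _ /mapP[c + ->].
  rewrite mem_enum => /imsetP[x xA ->]; apply/cards1P; exists x.
  apply/setP=> y; rewrite !inE; apply/andP/eqP=> [[yA /eqP]|->]; last by [].
  exact: fI.
move=> E; rewrite E; congr nseq.
have /and3P[_ _ /eqP <-] := pat_intpart f A.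
by rewrite [in RHS]E sumn_nseq mul1n.
Qed.

Lemma subset_card A k : k <= #|A| -> exists2 B : {set V}, B \subset A & #|B| = k.
Proof.
elim: k => [|k IH] kA; first by exists set0; rewrite ?sub0set ?cards0.
have [|B BA Bk] := IH; first exact: ltnW.
have /subsetPn[x xA xB] : ~~ (A \subset B).
  by apply: contraTN kA => /subset_leq_card; rewrite Bk -leqNgt.
by exists (x |: B); rewrite ?cardsU1 ?xB ?Bk // subUset sub1set xA.
Qed.

(** Greedy choice: while fewer than [k] vertices are chosen, their colours cannot cover [f @: A], so
    a vertex of a new colour can be added. *)
Lemma transversal_subset f A k : k <= #|f @: A| ->
  exists B : {set V}, [/\ B \subset A, #|B| = k & {in B &, injective f}].
Proof.
elim: k => [|k IH] kA.
  by exists set0; rewrite sub0set cards0; split=> // x y; rewrite inE.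
have [|B [BA Bk fI]] := IH; first exact: ltnW.
have /subsetPn[_ /imsetP[x xA ->] xB] : ~~ (f @: A \subset f @: B).
  by apply: contraTN kA => /subset_leq_card; rewrite (card_in_imset fI) Bk -leqNgt.
have nx y : y \in B -> f x <> f y by move=> yB E; case/negP: xB; rewrite E imset_f.
have xB' : x \notin B by apply: contraNN xB; apply: imset_f.
exists (x |: B); rewrite cardsU1 xB' Bk subUset sub1set xA BA; split=> // y z.
rewrite !inE => /orP[/eqP->|yB] /orP[/eqP->|zB] //; last exact: fI.
  by move/nx; case/(_ zB).
by move/esym/nx; case/(_ yB).
Qed.

Lemma pigeonhole f A k : (forall c, #|[set x in A | f x == c]| <= k) ->
  #|A| <= #|f @: A| * k.
Proof.
move=> H; rewrite -sum1_card (partition_big_imset f) /= -sum_nat_const.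
apply: leq_sum => c _; apply: leq_trans (H c); rewrite sum1_card.
by apply: subset_leq_card; apply/subsetP=> x; rewrite !inE.
Qed.

End Pattern.

(** * Renaming colours *)

Lemma eq_pat (V : finType) (C : eqType) (f g : V -> C) (K : {set V}) :
  f =1 g -> pat f K = pat g K.
Proof.
move=> fg; rewrite /pat (eq_image (frefl _) fg); congr sort; apply: eq_map => c.
by apply: eq_card => x; rewrite !inE fg.
Qed.

Lemma pat_comp (V : finType) (C D : eqType) (g : C -> D) (f : V -> C) (K : {set V}) :
  injective g -> pat (g \o f) K = pat f K.
Proof.
move=> gI; rewrite /pat.
have -> : [seq (g \o f) x | x in K] = map g [seq f x | x in K].
  by rewrite -map_comp.
rewrite (undup_map_inj gI) -map_comp; congr sort; apply: eq_map => c /=.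
by apply: eq_card => x; rewrite !inE (inj_eq gI).
Qed.

Lemma num_colours_comp (V C : finType) (g : C -> nat) (f : V -> C) :
  injective g -> num_colours (g \o f) = #|f @: [set: V]|.
Proof.
move=> gI; rewrite /num_colours /codom.
have -> : [seq (g \o f) x | x : V] = map g [seq f x | x : V].
  by rewrite -map_comp.
rewrite (undup_map_inj gI) size_map cardE; apply: perm_size; apply: uniq_perm.
- exact: undup_uniq.
- exact: enum_uniq.
move=> c; rewrite mem_undup mem_enum.
by apply/codomP/imsetP=> [[x ->]|[x _ ->]]; exists x.
Qed.

(** Patterns are invariant under injective renaming of colours, and a colouring takes finitely many
    values; so colours may come from any finite type, where image sets count them. *)
Lemma spectrumP (V : finType) (H : {set {set V}}) (Q : pred (seq nat)) k :
  in_Q_spectrum H Q k <->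
  exists (C : finType) (f : V -> C),
    (forall E, E \in H -> pat f E \in Q) /\ #|f @: [set: V]| = k.
Proof.
split=> [[f [fQ <-]]|[C [f [fQ <-]]]].
  pose g (x : V) : 'I_(\max_y f y).+1 := inord (f x).
  have fE : val \o g =1 f.
    by move=> x; rewrite /= inordK // ltnS; apply: leq_bigmax.
  exists _, g; split=> [E EH|].
    by rewrite -(pat_comp _ _ val_inj) (eq_pat _ fE); apply: fQ.
  by rewrite -(num_colours_comp _ val_inj) /num_colours (eq_codom fE).
pose g (c : C) : nat := val (enum_rank c).
have gI : injective g by move=> x y /val_inj /enum_rank_inj.
exists (g \o f); split; last exact: num_colours_comp.
by move=> E EH; rewrite pat_comp //; apply: fQ.
Qed.

(** * Building edges with prescribed class partition and pattern *)

Section SigmaHypergraph.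
Variables (n r q : nat) (Q : pred (seq nat)).
Hypothesis QP : {subset Q <= is_intpart r}.

Local Notation V := ('I_n * 'I_q)%type.
Local Notation H := (sigma_hypergraph n r q Q).

Definition vclass (i : 'I_n) : {set V} := [set v | v.1 == i].

Lemma card_vclass i : #|vclass i| = q.
Proof.
have -> : vclass i = [set (i, j) | j in 'I_q].
  apply/setP=> -[a b]; rewrite inE /=; apply/eqP/imsetP => [->|[j _ [-> _]] //].
  by exists b.
by rewrite card_imset ?card_ord // => j k [].
Qed.

Lemma edge_pat K : K \in H -> #|K| = r /\ pat fst K \in Q.
Proof. by rewrite inE => /andP[/eqP]. Qed.

Variables (C : finType) (f : V -> C).

(** The tool that forces partitions into [Q]: a class partition [s] in [Q] gives [K] size [r] and
    makes it an edge, so its pattern must be in [Q]. *)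
Lemma colouring_pat K s t : (forall E, E \in H -> pat f E \in Q) ->
  s \in Q -> perm_eq (pat fst K) s -> is_intpart r t -> perm_eq (pat f K) t ->
  t \in Q.
Proof.
move=> fQ sQ Ks tP Kt; have sP := QP sQ.
have cK : #|K| = r.
  have /and3P[_ _ /eqP<-] := pat_intpart fst K.
  by rewrite (perm_sumn Ks); have /and3P[_ _ /eqP] := sP.
have Es : pat fst K = s by apply: (@intpart_perm r) => //; rewrite -cK pat_intpart.
have <- : pat f K = t by apply: (@intpart_perm r) => //; rewrite -cK pat_intpart.
by apply: fQ; rewrite inE cK eqxx Es.
Qed.

(** The classes in [I] carry at most [q * #|I|] colours, so some vertex has a colour absent from all
    of them. Adding its class to [I] keeps later choices away from that class and its colours. *)
Lemma fresh_vertices (I : {set 'I_n}) k : 0 < q ->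
  q * (#|I| + k) <= #|f @: [set: V]| ->
  exists W : {set V}, [/\ #|W| = k, {in W &, injective fst}, {in W &, injective f} &
    forall v w, v.1 \in I -> w \in W -> (v.1 != w.1) && (f v != f w)].
Proof.
move=> q0; elim: k I => [|k IH] I kI.
  by exists set0; rewrite cards0; split=> // [x y|x y|v w _]; rewrite inE.
pose U := \bigcup_(i in I) vclass i.
have cU : #|U| <= q * #|I|.
  rewrite mulnC -sum_nat_const /U; elim/big_rec2: _ => [|i m A _ Am]; rewrite ?cards0 //.
  by apply: leq_trans (leq_card_setU _ _) _; rewrite card_vclass leq_add2l.
have /subsetPn[_ /imsetP[v _ ->] nv] : ~~ (f @: [set: V] \subset f @: U).
  apply: contraTN kI => /subset_leq_card fU; rewrite -ltnNge.
  apply: leq_ltn_trans (leq_trans fU (leq_trans (leq_imset_card f U) cU)) _.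
  by rewrite ltn_pmul2l // -addSnnS leq_addr.
have UP w : w.1 \in I -> f w != f v.
  move=> wI; apply: contraNneq nv => <-; apply: imset_f.
  by apply/bigcupP; exists w.1; rewrite // inE.
have vI : v.1 \notin I by apply/negP=> /UP; rewrite eqxx.
have [|W [cW fstI fI WP]] := IH (v.1 |: I); first by rewrite cardsU1 vI; lia.
have vW w : w \in W -> (v.1 != w.1) && (f v != f w) by apply: WP; rewrite !inE eqxx.
have vW' : v \notin W by apply/negP=> /vW; rewrite eqxx.
exists (v |: W); split; first by rewrite cardsU1 vW' cW.
- move=> x y; rewrite !inE => /orP[/eqP->|xW] /orP[/eqP->|yW] //; last exact: fstI.
    by case/andP: (vW _ yW) => /eqP.
  by case/andP: (vW _ xW) => /eqP + _ /esym.
- move=> x y; rewrite !inE => /orP[/eqP->|xW] /orP[/eqP->|yW] //; last exact: fI.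
    by case/andP: (vW _ yW) => _ /eqP.
  by case/andP: (vW _ xW) => _ /eqP + /esym.
move=> x y xI; rewrite !inE => /orP[/eqP->|yW].
  by rewrite UP // andbT; apply: contraNneq vI => <-.
by apply: WP => //; rewrite inE xI orbT.
Qed.

(** Within [K], each fresh vertex is alone in its class and in its colour, so it adds a part 1 to
    both partitions. *)
Lemma extend_fresh (A : {set V}) (I : {set 'I_n}) k :
  0 < q -> {in A, forall v, v.1 \in I} -> q * (#|I| + k) <= #|f @: [set: V]| ->
  exists K : {set V}, perm_eq (pat fst K) (pat fst A ++ nseq k 1) /\
                      perm_eq (pat f K) (pat f A ++ nseq k 1).
Proof.
move=> q0 AI kI; have [W [cW fstI fI WP]] := fresh_vertices q0 kI.
exists (A :|: W); rewrite -cW; split.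
  rewrite -(pat_inj fstI); apply: patU => a w /AI aI wW.
  by case/andP: (WP _ _ aI wW).
rewrite -(pat_inj fI); apply: patU => a w /AI aI wW.
by case/andP: (WP _ _ aI wW).
Qed.

Lemma extend_blocks (h : 'I_n -> C) (L : {set 'I_n}) (u : seq nat) (A : {set V}) :
  (forall i, r <= #|[set v in vclass i | f v == h i]|) ->
  {in L &, injective h} -> all (leq 1) u -> all (geq r) u -> size u <= #|L| ->
  (forall v i, v \in A -> i \in L -> (v.1 != i) && (f v != h i)) ->
  exists K : {set V}, perm_eq (pat fst K) (pat fst A ++ u) /\
                      perm_eq (pat f K) (pat f A ++ u).
Proof.
move=> hr; elim: u L A => [|a u IH] L A hI.
  by move=> _ _ _ _; exists A; rewrite !cats0.
move=> /= /andP[a0 u0] /andP[ar ur] su AL.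
have /card_gt0P[i iL] : 0 < #|L| by apply: leq_trans su.
have [|B] := @subset_card V [set v in vclass i | f v == h i] a.
  exact: leq_trans ar (hr i).
move=> /subsetP BP cB.
have {}BP v : v \in B -> v.1 = i /\ f v = h i.
  by move/BP; rewrite !inE => /andP[/eqP-> /eqP->].
have B0 : 0 < #|B| by rewrite cB.
have [|||||K [K1 K2]] := IH (L :\ i) (A :|: B).
- by move=> x y; rewrite !inE => /andP[_ xL] /andP[_ yL]; apply: hI.
- by [].
- by [].
- by move: su; rewrite (cardsD1 i L) iL; lia.
- move=> v j; rewrite !inE => /orP[vA|/BP[-> ->]] /andP[ji jL]; first exact: AL.
  by rewrite eq_sym ji /=; apply: contraNneq ji => /hI->.
exists K; split.
  rewrite (perm_trans K1) // -cat1s catA perm_cat2r.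
  rewrite -cB -(@pat_const _ _ fst B i) //; last by move=> v /BP[].
  by apply: patU => x y xA /BP[-> _]; case/andP: (AL _ _ xA iL).
rewrite (perm_trans K2) // -cat1s catA perm_cat2r.
rewrite -cB -(@pat_const _ _ f B (h i)) //; last by move=> v /BP[].
by apply: patU => x y xA /BP[_ ->]; case/andP: (AL _ _ xA iL).
Qed.

End SigmaHypergraph.

Lemma pigeonhole_ex (V C : finType) (f : V -> C) (A : {set V}) k :
  0 < k -> #|f @: A| * k.-1 < #|A| -> exists c, k <= #|[set v in A | f v == c]|.
Proof.
move=> k0 kA; apply/existsP; apply: contraTT kA => /existsPn nc; rewrite -leqNgt.
by apply: pigeonhole => c; move: (nc c); rewrite -ltnNge; lia.
Qed.

(** * Colour numbers attained by explicit colourings *)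

Section Spectra.
Variables (n r q : nat) (Q : pred (seq nat)).
Hypotheses (r0 : 0 < r) (n0 : 0 < n) (q0 : 0 < q).

Local Notation V := ('I_n * 'I_q)%type.
Local Notation H := (sigma_hypergraph n r q Q).

Lemma spectrum_1 : [:: r] \in Q -> in_Q_spectrum H Q 1.
Proof.
move=> rQ; apply/spectrumP; exists _, (fun=> tt); split.
  by move=> E /edge_pat[cE _]; rewrite (@pat_const _ _ _ _ tt) ?cE.
by rewrite -(cards1 tt); congr #|pred_of_set _|; apply/setP=> -[]; rewrite inE;
  apply/imsetP; exists (Ordinal n0, Ordinal q0).
Qed.

(** Colouring by classes makes the pattern of an edge its class partition, a member of [Q] because
    [Q] also serves as [Sigma]. *)
Lemma spectrum_classes : in_Q_spectrum H Q n.
Proof.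
apply/spectrumP; exists _, fst; split=> [E /edge_pat[]//|].
rewrite -[RHS]card_ord -cardsT; congr #|pred_of_set _|; apply/setP=> i; rewrite inE.
by apply/imsetP; exists (i, Ordinal q0).
Qed.

Lemma spectrum_vertices : nseq r 1 \in Q -> in_Q_spectrum H Q (n * q).
Proof.
move=> rQ; apply/spectrumP; exists _, id; split.
  by move=> E /edge_pat[cE _]; rewrite pat_inj ?cE // => x y.
by rewrite imset_id cardsT card_prod !card_ord.
Qed.

End Spectra.

(** * The case where [Q] is not simply-closed *)

Lemma gap_not_simply_closed r (Q : pred (seq nat)) m :
  {subset Q <= is_intpart r} -> 2 <= r -> [:: r] \in Q -> nseq r 1 \in Q ->
  0 < m <= r -> hook r m \notin Q ->
  Q_spectrum_has_gap (sigma_hypergraph (r * r) r 1 Q) Q.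
Proof.
move=> QP r2 MQ RQ /andP[m0 mr] mQ.
have m1 : m != 1 by apply: contraNneq mQ => ->; rewrite hook1 //; lia.
have mr' : m != r by apply: contraNneq mQ => ->; rewrite hookr.
exists 1, (r - m).+1, (r * r); split.
- by nia.
- by apply: spectrum_1 => //; lia.
- by rewrite -[X in in_Q_spectrum _ _ X]muln1; apply: spectrum_vertices.
move=> /spectrumP[C [f [fQ fk]]]; case/negP: mQ.
(* Some colour occurs [m] times since [(r - m + 1) * (m - 1) < r * r]. *)
have [||c] := @pigeonhole_ex _ _ f [set: 'I_(r * r) * 'I_1] m => //.
  by rewrite fk cardsT card_prod !card_ord; nia.
move=> /subset_card[A /subsetP Ac cA].
have {}Ac v : v \in A -> f v = c by move/Ac; rewrite !inE => /eqP.
have /card_gt0P[v vA] : 0 < #|A| by rewrite cA.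
(* With [q = 1] the colour bound is met with equality: each colour other than [c] is used once. Only
   [c] has to be avoided, so one class of [A] suffices. *)
have [||W [cW _ fI WP]] := @fresh_vertices _ 1 _ f [set v.1] (r - m) => //.
  by rewrite fk cards1; lia.
have Ef : perm_eq (pat f (A :|: W)) (hook r m).
  rewrite /hook -cat1s -cW -(pat_inj fI) -cA -(@pat_const _ _ f A c) ?cA //.
  apply: patU => x w /Ac-> wW; rewrite -(Ac v) //.
  by case/andP: (WP v w (set11 _) wW).
apply: (colouring_pat QP fQ RQ _ _ Ef); last by apply: hook_intpart; lia.
rewrite pat_inj; last by move=> [x i] [y j] _ _ /= ->; rewrite !ord1.
have /and3P[_ _ /eqP<-] := pat_intpart f (A :|: W).
by rewrite (perm_sumn Ef) /hook /= sumn_nseq mul1n subnKC.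
Qed.

(** * The case where [Q] is not reduction-closed *)

Section NotReductionClosed.
Variables (r : nat) (Q : pred (seq nat)) (m : nat).
Hypotheses (QP : {subset Q <= is_intpart r}) (r2 : 2 <= r).
Hypotheses (RQ : nseq r 1 \notin Q) (m0 : 0 < m) (mr : m < r).
Hypotheses (mQ : hook r m \notin Q) (mQ' : hook r m.+1 \in Q).

Let q := r * r.
Let n := (q * r).+1.
Local Notation H := (sigma_hypergraph n r q Q).
Variables (C : finType) (f : 'I_n * 'I_q -> C).
Hypotheses (fQ : forall E, E \in H -> pat f E \in Q).
Hypotheses (fn : #|f @: [set: 'I_n * 'I_q]| = n.-1).

Lemma few_colours_monochromatic v w : v.1 = w.1 -> f v = f w.
Proof.
set i := v.1 => wi; apply/eqP; apply/negPn/negP => vw.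
have r0 := ltnW r2; have q0 : 0 < q by rewrite muln_gt0 r0.
have [A Ai Apat] : exists2 A : {set 'I_n * 'I_q}, A \subset vclass q i &
    perm_eq (pat f A) [:: m; 1] \/ perm_eq (pat f A) (nseq m.+1 1).
  (* Either more than [m] colours give [m + 1] vertices of distinct colours, or some colour occurs
     [r] times among the [r * r] vertices and a vertex of another colour completes [(m, 1)]. *)
  have [nc|nc] := ltnP m #|f @: vclass q i|.
    have [A [Ai cA fI]] := transversal_subset nc.
    by exists A => //; right; rewrite pat_inj // cA.
  have [||c cr] := @pigeonhole_ex _ _ f (vclass q i) r; first by lia.
    by rewrite card_vclass; apply: ltn_mul; [apply: leq_ltn_trans nc mr | lia].
  have [x xi xc] : exists2 x, x.1 = i & f x != c.
    have [E|] := eqVneq (f v) c; last by exists v.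
    by exists w; rewrite -?wi // -E eq_sym.
  have [A /subsetP Ac cA] := subset_card (leq_trans (ltnW mr) cr).
  have {}Ac y : y \in A -> y.1 = i /\ f y = c.
    by move/Ac; rewrite !inE => /andP[/eqP-> /eqP->].
  exists (A :|: [set x]).
    by apply/subsetP=> y; rewrite !inE => /orP[/Ac[->]|/eqP->]; rewrite ?xi.
  left; rewrite -cA -(cards1 x).
  apply: (@pat_const2 _ _ _ _ _ c (f x)); rewrite ?cards1 ?cA // 1?eq_sym //.
    by move=> y /Ac[].
  by move=> y; rewrite inE => /eqP->.
have cA : #|A| = m.+1.
  have /and3P[_ _ /eqP<-] := pat_intpart f A.
  by case: Apat => /perm_sumn->; rewrite ?sumn_nseq ?mul1n //= addn0 addn1.
have {}Ai y : y \in A -> y.1 = i by move/(subsetP Ai); rewrite inE => /eqP.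
(* This needs [q * (1 + (r - m - 1))] colours, within the [q * r] available. *)
have [||K [K1 K2]] := @extend_fresh _ _ _ f A [set i] (r - m.+1) q0.
- by move=> y /Ai->; rewrite inE.
- by rewrite fn cards1 /= leq_pmul2l //; lia.
have {}K1 : perm_eq (pat fst K) (hook r m.+1).
  by rewrite (perm_trans K1) // (@pat_const _ _ _ _ i) ?cA.
case: Apat => Apat.
  case/negP: mQ; apply: (colouring_pat QP fQ mQ' K1); first by apply: hook_intpart; lia.
  by rewrite (perm_trans K2) // /hook -(subnSK mr) -[_ :: _]/([:: m; 1] ++ _) perm_cat2r.
case/negP: RQ; apply: (colouring_pat QP fQ mQ' K1).
  by rewrite -hook1 //; apply: hook_intpart; rewrite /= r0.
rewrite (perm_trans K2) // -[X in perm_eq _ (nseq X 1)](subnKC mr) nseqD.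
by rewrite perm_cat2r.
Qed.

End NotReductionClosed.

Lemma intpart_bound r s : is_intpart r s -> all (geq r) s /\ size s <= r.
Proof.
case/and3P=> _ + /eqP<-; elim: s => //= a s IH /andP[a0 /IH[s1 s2]].
split; last by rewrite -add1n leq_add.
rewrite leq_addr /=; apply/allP=> x /(allP s1) /= xs; exact: leq_trans xs (leq_addl _ _).
Qed.

Lemma gap_not_reduction_closed r (Q : pred (seq nat)) s t :
  {subset Q <= is_intpart r} -> 2 <= r -> [:: r] \in Q -> nseq r 1 \notin Q ->
  s \in Q -> is_intpart r t -> reduction s t -> t \notin Q ->
  Q_spectrum_has_gap (sigma_hypergraph (r * r * r).+1 r (r * r) Q) Q.
Proof.
move=> QP r2 MQ RQ sQ tP [a [b [u [su tu]]]] tQ; have r0 := ltnW r2.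
have q0 : 0 < r * r by rewrite muln_gt0 r0.
have r3 : r <= r * r * r by rewrite leq_pmull.
have [||m [m0 mr]] := @exists_switch (fun k => hook r k \notin Q) 1 r r2.
- by rewrite hook1 //; lia.
- by rewrite negbK hookr.
rewrite negbK => mQ mQ'.
exists 1, (r * r * r), (r * r * r).+1; split.
- by rewrite (leq_trans r2 r3) ltnSn.
- exact: spectrum_1.
- exact: spectrum_classes.
move=> /spectrumP[C [f [fQ fn]]]; case/negP: tQ.
have mono := few_colours_monochromatic QP r2 RQ m0 mr mQ mQ' fQ fn.
pose h i := f (i, Ordinal q0).
have fh v : f v = h v.1 by apply: mono.
have fhT : f @: [set: _] = h @: [set: _].
  apply/setP=> c; apply/imsetP/imsetP => [[v _ ->]|[i _ ->]]; last by exists (i, Ordinal q0).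
  by exists v.1; rewrite ?fh.
have /injectivePn[i [j ij hij]] : ~~ injectiveb h.
  apply/negP=> /injectiveP hI; move: fn.
  by rewrite fhT card_imset // cardsT card_ord => /esym/n_Sn.
have hT : h @: [set: _] = h @: ([set: _] :\ i).
  apply/setP=> c; apply/imsetP/imsetP => [[k _ ->]|[k _ ->]]; last by exists k.
  have [->|ki] := eqVneq k i; last by exists k; rewrite // !inE ki.
  by exists j; rewrite // !inE eq_sym ij.
have ci : #|[set: 'I_(r * r * r).+1] :\ i| = r * r * r.
  by have := cardsD1 i [set: 'I_(r * r * r).+1]; rewrite cardsT card_ord in_setT add1n => -[].
(* Dropping class [i] loses no colour and leaves as many classes as colours, so [i] and [j] are the
   only coincidence. *)
have /imset_injP hI : #|h @: ([set: _] :\ i)| == #|[set: 'I_(r * r * r).+1] :\ i|.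
  by rewrite -hT -fhT fn ci.
have sP := QP _ sQ; have [sr ss] := intpart_bound sP.
have /and3P[_ s0 _] := sP.
move: s0 sr ss; rewrite (perm_all _ su) (perm_all _ su) (perm_size su) /=.
move=> /and3P[a0 b0 u0] /and3P[ar br ur] ss.
have class_sub k x : x <= r -> exists2 A : {set 'I_(r * r * r).+1 * 'I_(r * r)},
    A \subset vclass (r * r) k & #|A| = x.
  by move=> xr; apply: subset_card; rewrite card_vclass (leq_trans xr) // leq_pmull.
(* Parts [a] and [b] are placed in the two classes of equal colour, so they merge to [a + b] in the
   pattern; [u] goes to other classes. *)
have [A /subsetP Ai cA] := class_sub i a ar; have [B /subsetP Bj cB] := class_sub j b br.
have {}Ai v : v \in A -> v.1 = i by move/Ai; rewrite inE => /eqP.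
have {}Bj v : v \in B -> v.1 = j by move/Bj; rewrite inE => /eqP.
have ABpat : perm_eq (pat fst (A :|: B)) [:: a; b].
  by rewrite -cA -cB; apply: (@pat_const2 _ _ _ _ _ i j); rewrite ?cA ?cB.
have ABf v : v \in A :|: B -> f v = h i.
  by rewrite inE fh => /orP[/Ai->|/Bj->].
have cAB : #|A :|: B| = a + b.
  have /and3P[_ _ /eqP<-] := pat_intpart fst (A :|: B).
  by rewrite (perm_sumn ABpat) /= addn0.
have [||||||K [K1 K2]] := @extend_blocks _ r _ _ f h ([set: _] :\ i :\ j) u (A :|: B).
- move=> k; have -> : [set v in vclass (r * r) k | f v == h k] = vclass (r * r) k.
    by apply/setP=> v; rewrite !inE fh; case: eqP => //= ->; rewrite eqxx.
  by rewrite card_vclass leq_pmull.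
- by move=> x y; rewrite !inE => /and3P[_ xi _] /and3P[_ yi _]; apply: hI; rewrite !inE ?xi ?yi.
- by [].
- by [].
- have := cardsD1 j ([set: 'I_(r * r * r).+1] :\ i); rewrite ci !inE eq_sym ij add1n => E.
  by rewrite -ltnS -E; apply: leq_trans (ltnW ss) r3.
- move=> v k vAB; rewrite !inE andbT => /andP[kj ki]; rewrite (ABf _ vAB).
  apply/andP; split.
    by move: vAB; rewrite inE => /orP[/Ai->|/Bj->]; rewrite eq_sym.
  by rewrite hij; apply: contraNneq kj => /hI->; rewrite // !inE ?ki // eq_sym ij.
apply: (colouring_pat QP fQ sQ (K := K) _ tP).
  rewrite perm_sym (perm_trans su) // perm_sym (perm_trans K1) //.
  by rewrite -[a :: _]/([:: a; b] ++ u) perm_cat2r.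
rewrite perm_sym (perm_trans tu) // perm_sym (perm_trans K2) //.
by rewrite (@pat_const _ _ _ _ (h i)) ?cAB // addn_gt0 a0.
Qed.

(** * The case where [Q] is not expansion-closed *)

Section NotExpansionClosed.
Variables (r : nat) (Q : pred (seq nat)) (m : nat).
Hypotheses (QP : {subset Q <= is_intpart r}) (r2 : 2 <= r).
Hypotheses (RQ : nseq r 1 \in Q) (m0 : 0 < m) (mr : m < r).
Hypotheses (mQ : hook r m \in Q) (mQ' : hook r m.+1 \notin Q).

Let q := 3 * r * r.
Let n := q * r.
Local Notation H := (sigma_hypergraph n r q Q).
Variables (C : finType) (f : 'I_n * 'I_q -> C).
Hypotheses (fQ : forall E, E \in H -> pat f E \in Q).
Hypotheses (fn : #|f @: [set: 'I_n * 'I_q]| = n.+1).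

Let q0 : 0 < q. Proof. by rewrite /q; nia. Qed.

(** Otherwise [w] and [m] vertices of colour [c] in class [i] have class partition [(m, 1)] and
    pattern [(m + 1)], and extend to an edge of pattern [hook r m.+1]. *)
Lemma frequent_colour_exclusive i c w :
  m <= #|[set v in vclass q i | f v == c]| -> f w = c -> w.1 = i.
Proof.
move=> /subset_card[A /subsetP Ac cA] wc; apply/eqP/negPn/negP => wi.
have {}Ac y : y \in A -> y.1 = i /\ f y = c.
  by move/Ac; rewrite !inE => /andP[/eqP-> /eqP->].
have Ef : pat f (w |: A) = [:: m.+1].
  have wA : w \notin A by apply: contraNN wi => /Ac[->].
  rewrite (@pat_const _ _ _ _ c) ?cardsU1 ?wA ?cA //.
  by move=> y; rewrite !inE => /orP[/eqP->|/Ac[]].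
have Efst : perm_eq (pat fst (w |: A)) [:: m; 1].
  rewrite setUC -cA -(cards1 w).
  apply: (@pat_const2 _ _ _ _ _ i w.1); rewrite ?cards1 ?cA // 1?eq_sym //.
    by move=> y /Ac[].
  by move=> y; rewrite inE => /eqP->.
have [||K [K1 K2]] := @extend_fresh _ _ _ f (w |: A) [set i; w.1] (r - m.+1) q0.
- by move=> y; rewrite !inE => /orP[/eqP->|/Ac[-> _]]; rewrite eqxx ?orbT.
(* Two classes are occupied, and [2 + (r - m - 1) <= r] because [m >= 1]. *)
- rewrite fn cards2 eq_sym wi; apply: leqW; rewrite leq_pmul2l //; lia.
case/negP: mQ'; apply: (colouring_pat QP fQ mQ (K := K)).
- by rewrite (perm_trans K1) // /hook -(subnSK mr) -[_ :: _]/([:: m; 1] ++ _) perm_cat2r.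
- by apply: hook_intpart; lia.
- by rewrite Ef in K2.
Qed.

(** Vertices of colour [c] from [m + 1] classes would extend to an edge with class partition all
    ones and pattern [hook r m.+1]. *)
Lemma colour_in_few_classes c : #|fst @: [set v | f v == c]| <= m.
Proof.
rewrite leqNgt; apply/negP=> /transversal_subset[A [/subsetP Ac cA fstI]].
have {}Ac y : y \in A -> f y = c by move/Ac; rewrite !inE => /eqP.
have [||K [K1 K2]] := @extend_fresh _ _ _ f A (fst @: A) (r - m.+1) q0.
- by move=> y yA; apply: imset_f.
- rewrite fn (card_in_imset fstI) cA; apply: leqW; rewrite leq_pmul2l //; lia.
case/negP: mQ'; apply: (colouring_pat QP fQ RQ (K := K)).
- rewrite (perm_trans K1) // -[X in perm_eq _ (nseq X 1)](subnKC mr) nseqD.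
  by rewrite (pat_inj fstI) cA.
- by apply: hook_intpart; lia.
- by rewrite (perm_trans K2) // (@pat_const _ _ _ A c) ?cA.
Qed.

(** Double counting of pairs of a class in [B] (no frequent colour) and a colour in it. With
    [b = #|B|], each such class has at least [3 * r] colours, each colour meets at most [m] classes,
    and at most [b + 1] colours occur there; but [3 * r * b <= (b + 1) * m] with [m < r] forces
    [b = 0]. *)
Lemma every_class_has_frequent_colour i :
  exists c, r <= #|[set v in vclass q i | f v == c]|.
Proof.
pose freq i c := r <= #|[set v in vclass q i | f v == c]|.
pose B := [set i | ~~ [exists c, freq i c]].
suff B0 : B = set0.
  have : i \notin B by rewrite B0 inE.
  by rewrite inE negbK => /existsP.
have n0 : 0 < n by rewrite /n; nia.
(* The default colour is arbitrary: [h] matters only off [B]. *)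
pose h i := odflt (f (Ordinal n0, Ordinal q0)) [pick c | freq i c].
have hP j : j \in ~: B -> freq j (h j).
  rewrite !inE negbK => /existsP[c jc]; rewrite /h; case: pickP => //= /(_ c).
  by rewrite jc.
pose D := f @: [set v | v.1 \in B].
have excl j v : j \in ~: B -> f v = h j -> v.1 = j.
  by move=> /hP jr; apply: frequent_colour_exclusive; apply: leq_trans (ltnW mr) jr.
have hf j : j \in ~: B -> exists2 v, f v = h j & v.1 = j.
  move=> jB; have /card_gt0P[v] : 0 < #|[set v in vclass q j | f v == h j]|.
    by apply: leq_trans (hP _ jB); lia.
  by rewrite !inE => /andP[/eqP vj /eqP vh]; exists v.
have hI : {in ~: B &, injective h}.
  move=> j k jB kB E; have [v vh <-] := hf j jB.
  by apply: excl => //; rewrite -E.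
have dis : [disjoint h @: (~: B) & D].
  apply/pred0P=> c /=; apply/negP => /andP[/imsetP[j jB ->] /imsetP[v]].
  by rewrite inE => vB /esym /(excl _ _ jB) vj; move: jB; rewrite inE -vj vB.
(* The frequent colours off [B] are distinct and do not occur in [B], which leaves at most
   [#|B| + 1] colours for [D]. *)
have cD : #|~: B| + #|D| <= n.+1.
  rewrite -(card_in_imset hI) -fn.
  have /leqifP := leq_card_setU (h @: ~: B) D; rewrite dis => /eqP<-.
  apply: subset_leq_card; apply/subsetP=> c; rewrite inE => /orP[/imsetP[j jB ->]|].
    by have [v <- _] := hf j jB; apply: imset_f.
  by case/imsetP=> v _ ->; apply: imset_f.
have cB : #|B| + #|~: B| = n by rewrite cardsC card_ord.
have lower : #|B| * (3 * r) <= \sum_(j in B) #|f @: vclass q j|.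
  rewrite -sum_nat_const; apply: leq_sum => j; rewrite inE => /existsPn nj.
  have : #|vclass q j| <= #|f @: vclass q j| * r.
    by apply: pigeonhole => c; move: (nj c); rewrite /freq; lia.
  by rewrite card_vclass /q leq_pmul2r //; lia.
have upper : \sum_(j in B) #|f @: vclass q j| <= #|D| * m.
  under eq_bigr => j _ do rewrite -sum1_card.
  rewrite (exchange_big_dep (mem D)) /=; last first.
    move=> j c jB /imsetP[v]; rewrite inE => /eqP vj ->; apply: imset_f.
    by rewrite inE vj.
  rewrite -sum_nat_const; apply: leq_sum => c _; rewrite sum1_card.
  apply: leq_trans (colour_in_few_classes c); apply: subset_leq_card.
  apply/subsetP=> j /andP[_ /imsetP[v]]; rewrite inE => /eqP<- ->; apply: imset_f.
  by rewrite inE.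
apply/eqP; rewrite -cards_eq0; move: lower upper cD cB.
move: (\sum_(j in B) _) #|B| #|~: B| #|D| => S b b' d; nia.
Qed.

End NotExpansionClosed.

Lemma gap_not_expansion_closed r (Q : pred (seq nat)) s t :
  {subset Q <= is_intpart r} -> 2 <= r -> nseq r 1 \in Q -> [:: r] \notin Q ->
  s \in Q -> is_intpart r t -> expansion s t -> t \notin Q ->
  Q_spectrum_has_gap (sigma_hypergraph (3 * r * r * r) r (3 * r * r) Q) Q.
Proof.
move=> QP r2 RQ MQ sQ tP [a [u [a2 su tu]]] tQ; have r0 := ltnW r2.
have [||m [m0 mr mQ mQ']] := @exists_switch (fun k => hook r k \in Q) 1 r r2.
- by rewrite hook1 //; lia.
- by rewrite hookr.
set q := 3 * r * r; set n := q * r.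
have q0 : 0 < q by rewrite !muln_gt0 r0.
have q1 : 1 < q by rewrite /q -mulnA (leq_trans r2) // (leq_trans (leq_pmull r r0)) ?leq_pmull.
have rn : r <= n by rewrite leq_pmull.
exists n, n.+1, (n * q); split.
- by rewrite ltnSn -[n.+1]addn1; have := leq_mul (leqnn n) q1; lia.
- exact: spectrum_classes.
- exact: spectrum_vertices.
move=> /spectrumP[C [f [fQ fn]]]; case/negP: tQ.
have /fin_all_exists[h hr] := every_class_has_frequent_colour QP r2 RQ m0 mr mQ mQ' fQ fn.
have excl i v : f v = h i -> v.1 = i.
  apply: (frequent_colour_exclusive QP r2 RQ m0 mr mQ mQ' fQ fn).
  by apply: leq_trans (hr i); apply: ltnW.
have hI : injective h.
  move=> i j E; have /card_gt0P[v] : 0 < #|[set v in vclass q i | f v == h i]|.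
    exact: leq_trans r0 (hr i).
  by rewrite !inE => /andP[/eqP vi /eqP vh]; rewrite -vi; apply: excl; rewrite vh.
(* The frequent colours number only [n], so some vertex [v] carries the extra colour. *)
have /subsetPn[_ /imsetP[v _ ->] vh] : ~~ (f @: [set: _] \subset h @: [set: _]).
  by apply/negP=> /subset_leq_card; rewrite fn card_imset // cardsT card_ord ltnn.
have {}vh i : f v != h i by apply: contraNneq vh => ->; apply: imset_f.
have sP := QP _ sQ; have [sr ss] := intpart_bound sP.
have /and3P[_ s0 _] := sP.
move: s0 sr ss; rewrite (perm_all _ su) (perm_all _ su) (perm_size su) /=.
move=> /andP[a0 u0] /andP[ar ur] ss.
(* These [a - 1] vertices and [v] form a part [a] of the class partition that splits into [a - 1]
   and 1 in the pattern. *)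
have [|A /subsetP Ah cA] := @subset_card _ [set w in vclass q v.1 | f w == h v.1] a.-1.
  by apply: leq_trans (hr _); apply: leq_trans (leq_pred a) ar.
have {}Ah y : y \in A -> y.1 = v.1 /\ f y = h v.1.
  by move/Ah; rewrite !inE => /andP[/eqP-> /eqP->].
have fA : perm_eq (pat f (A :|: [set v])) [:: a.-1; 1].
  rewrite -cA -(cards1 v).
  apply: (@pat_const2 _ _ _ _ _ (h v.1) (f v)); rewrite ?cards1 1?eq_sym //.
  - by rewrite cA -ltnS prednK.
  - by move=> y /Ah[].
  - by move=> y; rewrite inE => /eqP->.
have fstA : pat fst (A :|: [set v]) = [:: a].
  have ca : #|A :|: [set v]| = a.
    have /and3P[_ _ /eqP<-] := pat_intpart f (A :|: [set v]).
    by rewrite (perm_sumn fA) /= addn1 prednK.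
  rewrite (@pat_const _ _ _ _ v.1) ?ca //.
  by move=> y; rewrite !inE => /orP[/Ah[]|/eqP->].
have [|||||K [K1 K2]] := @extend_blocks _ r _ _ f h ([set: _] :\ v.1) u (A :|: [set v]) hr.
- by move=> x y _ _; apply: hI.
- by [].
- by [].
- have := cardsD1 v.1 [set: 'I_n]; rewrite cardsT card_ord in_setT add1n => E.
  by rewrite -ltnS -E; apply: leq_trans ss rn.
- move=> x k; rewrite !inE andbT => /orP[/Ah[-> ->]|/eqP->] kv; rewrite eq_sym kv //=.
  by rewrite (inj_eq hI) eq_sym.
apply: (colouring_pat QP fQ sQ (K := K) _ tP).
  by rewrite perm_sym (perm_trans su) // perm_sym (perm_trans K1) // fstA.
rewrite perm_sym (perm_trans tu) // perm_sym (perm_trans K2) //.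
by rewrite -[[:: _, _ & _]]/([:: a.-1; 1] ++ u) perm_cat2r.
Qed.

(** * Choosing the case from the failing closure property *)

Theorem theorem4p2 (r : nat) (Q : pred (seq nat)) (hr : 2 <= r)
    (QP : {subset Q <= is_intpart r})
    (hMR : [:: r] \in Q \/ nseq r 1 \in Q)
    (hQ : ~ robust r Q) :
  exists (n q : nat) (Sigma : pred (seq nat)),
    [/\ 0 < n, 0 < q, {subset Sigma <= is_intpart r}
      & Q_spectrum_has_gap (sigma_hypergraph n r q Sigma) Q].
Proof.
(* Classical logic turns failed closure into a concrete pair, for reduction and expansion alike. *)
have not_closed (rel : seq nat -> seq nat -> Prop) :
    ~ (forall s t, s \in Q -> is_intpart r t -> rel s t -> t \in Q) ->
    exists s t, [/\ s \in Q, is_intpart r t, rel s t & t \notin Q].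
  move=> nrel; apply: NNPP => nst; apply: nrel => s t sQ tP st.
  by apply/negPn/negP=> tQ; apply: nst; exists s, t.
have [MQ|MQ] := boolP ([:: r] \in Q).
  have [RQ|RQ] := boolP (nseq r 1 \in Q).
    have /existsP[j jQ] : [exists j : 'I_r, (r - j) :: nseq j 1 \notin Q].
      apply: contra_notT hQ => /existsPn H; apply: Or33 => j jr.
      by have := H (Ordinal jr); rewrite negbK.
    exists (r * r), 1, Q; split=> //; first by rewrite muln_gt0; lia.
    have jr := ltn_ord j.
    apply: (gap_not_simply_closed (m := r - j)) => //; first by lia.
    by rewrite /hook subKn // ltnW.
  have [|s [t [sQ tP st tQ]]] := not_closed reduction.
    by move=> H; apply: hQ; apply: Or31.
  exists (r * r * r).+1, (r * r), Q; split=> //; first by nia.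
  exact: gap_not_reduction_closed sQ tP st tQ.
have RQ : nseq r 1 \in Q by case: hMR => // MQ'; rewrite MQ' in MQ.
have [|s [t [sQ tP st tQ]]] := not_closed expansion.
  by move=> H; apply: hQ; apply: Or32.
exists (3 * r * r * r), (3 * r * r), Q; split=> //; [by nia|by nia|].
exact: gap_not_expansion_closed sQ tP st tQ.
Qed.
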